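(* Let $\mathbf{p}=(p_1,\dots,p_n)$ be a probability distribution with all $p_i>0$, let $Z>0$ be an integer, and let $g:(0,\infty)\to\mathbb{R}$ be convex with $g(1)=0$. Run the following algorithm: (1) For each $i$, set $M_i:=\lfloor Zp_i\rfloor$ if $g(\lfloor Zp_i\rfloor/(Zp_i))\le g((\lfloor Zp_i\rfloor+1)/(Zp_i))$, and $M_i:=\lfloor Zp_i\rfloor+1$ otherwise. (2) For an integer vector $\mathbf{W}$, $i\in\{1,\dots,n\}$ and $\delta\in\{+1,-1\}$ let $\epsilon(\mathbf{W},i,\delta):=p_i[g((W_i+\delta)/(Zp_i))-g(W_i/(Zp_i))]$, or $\infty$ if $W_i+\delta\notin\{0,\dots,Z\}$. (3) Repeat: choose $(j,j')$ with $j\ne j'$ minimizing $\epsilon(\mathbf{M},j,+1)+\epsilon(\mathbf{M},j',-1)$; if this value is negative, set $M_j\gets M_j+1$, $M_{j'}\gets M_{j'}-1$ and repeat; otherwise stop. (4) Let $S:=(M_1+\dots+M_n)-Z$. (5) If $S=0$ return $\mathbf{M}$. (6) Let $\delta_S:=+1$ if $S<0$ and $\delta_S:=-1$ if $S>0$. (7) Repeat $|S|$ times: choose $j$ minimizing $\epsilon(\mathbf{M},j,\delta_S)$ and set $M_j\gets M_j+\delta_S$. (8) Return $\mathbf{M}$. (Ties in the minimizations are broken arbitrarily.) Then the algorithm terminates and the returned $\mathbf{M}$ lies in $\mathcal{M}[n,Z]$ and minimizes $\Delta_g(\mathbf{p},\mathbf{M})=\sum_{i=1}^n p_i\,g\!\left(\frac{M_i}{Zp_i}\right)$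 over all $\mathbf{M}\in\mathcal{M}[n,Z]$, i.e. the $Z$-type distribution $(M_1/Z,\dots,M_n/Z)$ minimizes the $f$-divergence $\Delta_g(\mathbf{p},\cdot)$ among all $Z$-type distributions.
   Context: $\mathcal{M}[n,Z]:=\{(M_1,\dots,M_n)\in\mathbb{Z}_{\ge0}^n:\sum_iM_i=Z\}$. A distribution $\mathbf{q}$ on $\{1,\dots,n\}$ is $Z$-type if each $q_i\in\{0/Z,1/Z,\dots,Z/Z\}$; $\mathbf{M}\in\mathcal{M}[n,Z]$ is identified with the $Z$-type distribution $q_i=M_i/Z$. The $f$-divergence with generator $g$ is $\Delta_g(\mathbf{p},\mathbf{q})=\sum_ip_i\,g(q_i/p_i)$. The value $g(0)$ is understood as $\lim_{t\to0^+}g(t)\in\mathbb{R}\cup\{+\infty\}$.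
   Formalization: In step (7) only j with M_j+δ_S in {0,…,Z} may be chosen, even among ties at ∞; with fully arbitrary ties the claim fails when g(0)=+∞ and Z<n (e.g. n=3, Z=1, p uniform, g=-log can return (-1,1,1)). *)

(* Defs.v *)
From Stdlib Require Import Relation_Operators.
From HB Require Import structures.
From mathcomp Require Import all_boot all_order all_algebra.
From mathcomp Require Import all_classical all_reals all_analysis.
Set Implicit Arguments.
Unset Strict Implicit.
Unset Printing Implicit Defensive.
Import Order.TTheory GRing.Theory Num.Theory.
Import numFieldNormedType.Exports.
Local Open Scope classical_set_scope.
Local Open Scope ring_scope.

Section Definitions.
Variables (R : realType) (n : nat).

Definition prob_vector (q : 'I_n -> R) : Prop :=
  (forall i, 0 <= q i) /\ \sum_(i < n) q i = 1.

Definition Ztype (Z : nat) (q : 'I_n -> R) : Prop :=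
  prob_vector q /\
  forall i, exists k : nat, (k <= Z)%N /\ q i = k%:R / Z%:R.

Definition count_vectors (Z : nat) : set {ffun 'I_n -> int} :=
  [set M | (forall i, 0 <= M i) /\ \sum_(i < n) M i = Z%:Z].

Definition empirical (Z : nat) (M : {ffun 'I_n -> int}) : 'I_n -> R :=
  fun i => (M i)%:~R / Z%:R.

(* The generator g : (0, +oo) -> R is a function R -> R of which only the
   values at positive points are used.  [gext g] is its extension to [0, +oo[
   with value in R u {+oo} at 0 (for convex g the limit at 0+ exists and is
   not -oo).  Its values at negative points are irrelevant. *)
Definition gext (g : R -> R) (x : R) : \bar R :=
  if 0 < x then (g x)%:E else lim ((g t)%:E @[t --> 0^'+]).

Definition fdiv (g : R -> R) (p q : 'I_n -> R) : \bar R :=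
  (\sum_(i < n) (p i)%:E * gext g (q i / p i)%R)%E.

Definition fdiv_count (g : R -> R) (p : 'I_n -> R) (Z : nat)
    (M : {ffun 'I_n -> int}) : \bar R :=
  (\sum_(i < n) (p i)%:E * gext g ((M i)%:~R / (Z%:R * p i))%R)%E.

Section Algorithm.
Variables (p : 'I_n -> R) (Z : nat) (g : R -> R).
Implicit Types (M W : {ffun 'I_n -> int}) (i j : 'I_n) (d : int).

Definition init_vector : {ffun 'I_n -> int} :=
  [ffun i => let m := Num.floor (Z%:R * p i) in
     if (gext g (m%:~R / (Z%:R * p i))%R
           <= gext g ((m + 1)%:~R / (Z%:R * p i))%R)%E
     then m else m + 1].

Definition in_range W i d : bool := 0 <= W i + d <= Z%:Z.

Definition eps W i d : \bar R :=
  if in_range W i d then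
    ((p i)%:E * (gext g ((W i + d)%:~R / (Z%:R * p i))%R
                 - gext g ((W i)%:~R / (Z%:R * p i))%R))%E
  else +oo%E.

Definition shift_entry M j d : {ffun 'I_n -> int} :=
  [ffun i => if i == j then M i + d else M i].

(* The convention -oo + +oo = -oo of \bar R plays no role on the runs below:
   a term -oo would need M j = 0 and g(0) = +oo, but if g(0) = +oo then
   [init_vector] and all vectors obtained from it by [exchange] are >= 1. *)
Definition eps2 M j j' : \bar R := (eps M j 1 + eps M j' (-1))%E.

Definition best_pair M j j' : Prop :=
  j != j' /\ forall k k', k != k' -> (eps2 M j j' <= eps2 M k k')%E.

Definition exchange M M' : Prop :=
  exists j j', [/\ best_pair M j j', (eps2 M j j' < 0)%E
                 & M' = shift_entry (shift_entry M j 1) j' (-1)].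

(* The value +oo given by [eps] to a move leaving {0, ..., Z} means that the
   move is forbidden.  It is thus never selected, even when it is tied with
   in-range moves of cost +oo, which happens only if g(0) = +oo and Z < n. *)
Definition adjust d M M' : Prop :=
  exists j, [/\ in_range M j d,
                forall k, (eps M j d <= eps M k d)%E
              & M' = shift_entry M j d].

Definition surplus M : int := \sum_(i < n) M i - Z%:Z.

Definition adjust_sign M : int := if surplus M < 0 then 1 else -1.

(* [Exchanging M]: loop of step (3); [Adjusting k d M]: k iterations of step
   (7) left, with increment d; [Returned M]: the algorithm has returned M. *)
Inductive state :=
  | Exchanging of {ffun 'I_n -> int}
  | Adjusting of nat & int & {ffun 'I_n -> int}
  | Returned of {ffun 'I_n -> int}.

Inductive step : state -> state -> Prop :=
  | StepExchange M M' :
      exchange M M' -> step (Exchanging M) (Exchanging M')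
  | StepStop0 M :
      (forall M', ~ exchange M M') -> surplus M = 0 ->
      step (Exchanging M) (Returned M)
  | StepStop M :
      (forall M', ~ exchange M M') -> surplus M != 0 ->
      step (Exchanging M) (Adjusting `|surplus M|%N (adjust_sign M) M)
  | StepAdjust k d M M' :
      adjust d M M' -> step (Adjusting k.+1 d M) (Adjusting k d M')
  | StepReturn d M :
      step (Adjusting 0 d M) (Returned M).

Definition initial_state : state := Exchanging init_vector.

Definition reachable (s : state) : Prop :=
  clos_refl_trans state step initial_state s.

(* Every run, whatever the tie-breaking, reaches [Returned M] for some M
   after finitely many steps: no run is infinite and none gets stuck. *)
Definition terminates : Prop :=
  (~ exists s : nat -> state,
       s 0%N = initial_state /\ forall k, step (s k) (s k.+1)) /\
  (forall s, reachable s ->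
     (exists M, s = Returned M) \/ (exists s', step s s')).

Definition returns M : Prop := reachable (Returned M).

End Algorithm.
End Definitions.

(* Main.v *)
(* With c_i(m) = p_i g(m / (Z p_i)), a convex function of the integer m, the
   divergence is the separable sum of the c_i(M_i).  Call M balanced when no
   left marginal c_i(M_i) - c_i(M_i - 1) exceeds a right marginal
   c_j(M_j + 1) - c_j(M_j).  The exchange loop strictly decreases the cost over a
   finite box, so it stops, and it stops at a balanced vector; by convexity a
   greedy move keeps the vector balanced; and a balanced vector minimizes the
   cost among vectors with the same sum, since any number separating the left
   from the right marginals is a common slope of supporting lines.  If
   g(0) = +oo, the same argument is run with counts bounded below by 1. *)
Require Import Defs.
From Stdlib Require Import Relation_Operators.
From mathcomp Require Import all_boot all_order all_algebra.
From mathcomp Require Import all_classical all_reals all_analysis.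
From mathcomp Require Import zify ring lra.
Set Implicit Arguments.
Unset Strict Implicit.
Unset Printing Implicit Defensive.
Import Order.TTheory GRing.Theory Num.Theory.
Import numFieldNormedType.Exports.
Local Open Scope classical_set_scope.
Local Open Scope ring_scope.

(** * Convex generators and their limit at 0 *)

Section ConvexGenerator.
Variables (R : realType) (g : R -> R).
Hypothesis g_convex : convex_function (E := R^o) `]0, +oo[ g.

(** Convexity with weight [(z - y) / (z - x)] on [x], cleared of denominators to suit linear
    arithmetic. *)
Lemma convex_chord (x y z : R) : 0 < x -> x < y -> y < z ->
  (z - x) * g y <= (z - y) * g x + (y - x) * g z.
Proof.
move=> x0 xy yz.
have zx : 0 < z - x by lra.
pose t := (z - y) / (z - x).
have t0 : 0 <= t by rewrite divr_ge0//; lra.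
have t1 : t <= 1 by rewrite ler_pdivrMr// mul1r; lra.
have D (w : R) : 0 < w -> w \in `]0, +oo[%classic.
  by move=> w0; rewrite inE/= in_itv/= w0.
have := @g_convex (Itv01 t0 t1) _ _ (D x x0) (D z (lt_trans (lt_trans x0 xy) yz)).
set w : R := (X in g X <= _).
have -> : w = y by rewrite [w]convRE/= /unstable.onem /t; field; lra.
rewrite -(ler_pM2l zx) convRE/=; congr (_ <= _).
by rewrite /unstable.onem /t; field; lra.
Qed.

(* Convexity makes [g] minus its secant over [1, 2] nonincreasing on (0, 1),
   so its right limit at 0 exists as a supremum. *)
Let slope := g 2 - g 1.
Let f (t : R) := g t - slope * t.

Let f_noninc (s t : R) : 0 < s -> s <= t -> t < 1 -> f t <= f s.
Proof.
move=> s0; rewrite le_eqVlt => /predU1P[->//|st] t1.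
(* Slopes of [g] increase, so those over [[s, t]] and [[t, 1]] are at most [slope], the slope over
   [[1, 2]]. *)
have h1 := @convex_chord s t 1 s0 st t1.
have h2 := @convex_chord t 1 2 (lt_trans s0 st) t1 (ltr1n _ 2).
have h3 : g 1 - g t <= (1 - t) * slope by rewrite /slope; nra.
rewrite /f.
have h4 : (t - s) * (g 1 - g t) <= (t - s) * ((1 - t) * slope).
  by rewrite ler_pM2l// subr_gt0.
have h5 : (1 - t) * (g t - slope * t) <= (1 - t) * (g s - slope * s) by nra.
by rewrite ler_pM2l ?subr_gt0 in h5.
Qed.

Lemma gext_pos (x : R) : 0 < x -> gext g x = (g x)%:E.
Proof. by rewrite /gext => ->. Qed.

(** The linear part [slope * t] tends to 0, so [g] has the same right limit as the monotone [f]. *)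
Lemma gext0E : gext g 0 = ereal_sup ((fun t => (f t)%:E) @` `]0, 1[%classic).
Proof.
rewrite /gext ltxx; apply: cvg_lim => //.
have -> : (fun t => (g t)%:E) = (fun t => (f t)%:E) \+ (fun t => (slope * t)%:E).
  by apply/funext => t /=; rewrite -EFinD /f subrK.
rewrite -[X in _ --> X]adde0; apply: cvgeD.
- by rewrite fin_num_adde_defl.
- apply: nonincreasing_at_right_cvge; first by rewrite bnd_simp.
  move=> s t; rewrite !in_itv/= => /andP[s0 s1] /andP[t0 t1] st.
  by rewrite lee_fin f_noninc.
- apply: cvg_EFin; first by near=> t.
  apply: cvg_at_right_filter.
  rewrite -[X in _ --> X](mulr0 slope).
  by apply: cvgMr; exact: cvg_id.
Unshelve. all: by end_near.
Qed.

Let gext0_ge (t : R) : 0 < t < 1 -> ((g t - slope * t)%:E <= gext g 0)%E.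
Proof.
move=> t01; rewrite gext0E; apply: ereal_sup_ubound.
by exists t => //=; rewrite in_itv.
Qed.

Lemma gext0_neq_ninfty : gext g 0 != -oo%E.
Proof.
rewrite -ltNye; apply: lt_le_trans (@gext0_ge 2^-1 _); first exact: ltNyr.
by apply/andP; split; lra.
Qed.

(** Convexity is given at positive points only, so 0 is replaced by a small [t] and the error is
    absorbed in an arbitrary [e]. *)
Lemma gext_midpoint0 (x : R) : 0 < x -> gext g 0 != +oo%E ->
  2 * g x <= fine (gext g 0) + g (2 * x).
Proof.
move=> x0 g0.
have g0f : gext g 0 \is a fin_num by rewrite fin_numE gext0_neq_ninfty.
set r := fine (gext g 0).
have rE : gext g 0 = r%:E by rewrite fineK.
(* After multiplication by [x], replacing 0 by [t] costs at most [t * K], and [t] is chosen so that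
   [t * K <= e * x]. The summand 1 keeps [K] positive. *)
pose K := 1 + `|- g x + g (2 * x) - x * slope|.
have K0 : 0 < K by rewrite ltr_pwDl.
apply/ler_addgt0Pr => e e0.
pose t := Num.min (Num.min (x / 2) (1 / 2)) (e * x / K).
have t0 : 0 < t by rewrite !lt_min !divr_gt0// mulr_gt0.
have tx : t < x by rewrite !gt_min; apply/orP; left; apply/orP; left; lra.
have t1 : t < 1 by rewrite !gt_min; apply/orP; left; apply/orP; right; lra.
have tK : t * K <= e * x by rewrite -ler_pdivlMr// ge_min lexx orbT.
have h1 := @convex_chord t x (2 * x) t0 tx (_ : x < 2 * x).
have {}h1 := h1 ltac:(lra).
have h2 : g t - slope * t <= r.
  by rewrite -lee_fin -rE gext0_ge// t0.
have h3 : x * (g t) <= x * (r + slope * t) by rewrite ler_pM2l//; lra.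
have h4 : t * (-(- g x + g (2 * x) - x * slope)) <= t * K.
  rewrite ler_pM2l//; apply: le_trans (ler_norm _) _.
  by rewrite normrN /K lerDr.
rewrite -(ler_pM2l x0); nra.
Qed.

End ConvexGenerator.

(** * Costs of integer counts *)

Section Cost.
Variables (R : realType) (n : nat) (p : 'I_n -> R) (Z : nat) (g : R -> R).
Implicit Types (M : {ffun 'I_n -> int}) (i j : 'I_n) (m d : int).

(** [fine] turns [+oo] into 0, so this is the true cost only for counts at least [min_count]. *)
Definition cost i m : R := p i * fine (gext g (m%:~R / (Z%:R * p i))).

(* The smallest count at which [gext g] is finite. *)
Definition min_count : int := if gext g 0 == +oo%E then 1 else 0.

Lemma min_count_ge0 : 0 <= min_count.
Proof. by rewrite /min_count; case: ifP. Qed.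

Lemma min_count_le1 : min_count <= 1.
Proof. by rewrite /min_count; case: ifP. Qed.

Lemma gext_count_pinfty i m : 0 <= m -> m < min_count ->
  gext g (m%:~R / (Z%:R * p i)) = +oo%E.
Proof.
rewrite /min_count; case: ifPn => [/eqP g0 m0 m1|g0 m0 m1]; last by lia.
have -> : m = 0 by lia.
by rewrite mul0r.
Qed.

Hypotheses (p_gt0 : forall i, 0 < p i) (Z_gt0 : (0 < Z)%N).
Hypothesis g_convex : convex_function (E := R^o) `]0, +oo[ g.

Let Zp_gt0 i : 0 < Z%:R * p i.
Proof. by rewrite mulr_gt0// ltr0n. Qed.

Lemma gext_neq_ninfty (x : R) : 0 <= x -> gext g x != -oo%E.
Proof.
rewrite le_eqVlt => /predU1P[<-|x0]; first exact: gext0_neq_ninfty.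
by rewrite gext_pos.
Qed.

Let ratio_ge0 i m : 0 <= m -> 0 <= m%:~R / (Z%:R * p i).
Proof. by move=> m0; rewrite divr_ge0 ?ler0z// ltW. Qed.

Lemma gext_count_fin i m : min_count <= m ->
  gext g (m%:~R / (Z%:R * p i)) \is a fin_num.
Proof.
rewrite /min_count; case: ifPn => [_ m1|g0 m0].
  by rewrite gext_pos// divr_gt0// ltr0z; lia.
rewrite fin_numE gext_neq_ninfty ?ratio_ge0//=.
have [->|m_neq0] := eqVneq m 0; first by rewrite mul0r.
by rewrite gext_pos// divr_gt0// ltr0z; lia.
Qed.

(** The three arguments of [g] are equally spaced, so this is midpoint convexity. *)
Lemma cost_convex i m : min_count <= m - 1 ->
  2 * cost i m <= cost i (m - 1) + cost i (m + 1).
Proof.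
move=> m1; have m0 : 0 < m by have := min_count_ge0; lia.
rewrite /cost -mulrDr mulrCA ler_pM2l//.
pose x := m%:~R / (Z%:R * p i); pose h := (Z%:R * p i)^-1.
have h0 : 0 < h by rewrite invr_gt0.
have x0 : 0 < x by rewrite divr_gt0// ltr0z.
have -> : (m - 1)%:~R / (Z%:R * p i) = x - h.
  by rewrite /x /h intrB mulrBl mul1r.
have -> : (m + 1)%:~R / (Z%:R * p i) = x + h.
  by rewrite /x /h intrD mulrDl mul1r.
rewrite -/x (@gext_pos _ _ (x + h)) ?addr_gt0// gext_pos//=.
(* For [m = 1] the left argument is 0, and the bound on [m] forces the limit there to be finite. *)
have [m_1|m_neq1] := eqVneq m 1.
  have xh : x = h by rewrite /x m_1 mul1r.
  have g0 : gext g 0 != +oo%E.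
    by move: m1; rewrite m_1 /min_count; case: ifP.
  rewrite xh subrr -mulr2n -[h *+ 2]mulr_natl.
  exact: gext_midpoint0 g_convex _ h0 g0.
have xh : 0 < x - h.
  rewrite /x /h -[X in _ - X]mul1r -mulrBl divr_gt0//.
  by rewrite subr_gt0 ltr1z; lia.
rewrite gext_pos//=.
have := @convex_chord _ _ g_convex (x - h) x (x + h) xh.
move=> /(_ ltac:(lra) ltac:(lra)) H.
by rewrite -(ler_pM2l h0); lra.
Qed.

(** Leaving [{0, ..., Z}] and entering a count of infinite cost both give [+oo], so the two cases
    merge into one range starting at [min_count]. *)
Lemma epsE M i d : min_count <= M i ->
  eps p Z g M i d =
  if min_count <= M i + d <= Z%:Z then (cost i (M i + d) - cost i (M i))%:E
  else +oo%E.
Proof.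
move=> Mi; rewrite /eps /in_range.
have lo0 := min_count_ge0.
have [loMd|loMd] := leP min_count (M i + d); last first.
  case: ifP => // /andP[Md _].
  rewrite (gext_count_pinfty i Md loMd)// -(fineK (gext_count_fin i Mi)).
  by rewrite addye// gt0_muley// lte_fin.
rewrite (le_trans lo0 loMd)/=; case: ifP => // _.
rewrite -(fineK (gext_count_fin i Mi)).
rewrite -(fineK (gext_count_fin i loMd)).
by rewrite -EFinB -EFinM mulrBr.
Qed.

Lemma fdiv_count_fin M : (forall i, min_count <= M i) ->
  fdiv_count g p Z M = (\sum_(i < n) cost i (M i))%:E.
Proof.
move=> loM; rewrite /fdiv_count -sumEFin; apply: eq_bigr => i _.
by rewrite -(fineK (gext_count_fin i (loM i))) -EFinM.
Qed.

(** No term is [-oo], so a single term [+oo] decides the sum. *)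
Lemma fdiv_count_pinfty M i : (forall j, 0 <= M j) -> M i < min_count ->
  fdiv_count g p Z M = +oo%E.
Proof.
move=> M0 Mi; apply/esum_eqyP => [j _|].
  have := gext_neq_ninfty (ratio_ge0 j (M0 j)).
  case: gext => //= _; by rewrite gt0_muley// lte_fin.
exists i; split; rewrite ?mem_index_enum//.
by rewrite gext_count_pinfty// gt0_muley// lte_fin.
Qed.

End Cost.

(** * Sums after a change of one entry *)

Section ShiftEntry.
Variable n : nat.
Implicit Types (M : {ffun 'I_n -> int}) (j : 'I_n) (d : int).

Lemma sum_shift_entry M j d :
  \sum_(i < n) shift_entry M j d i = \sum_(i < n) M i + d.
Proof.
rewrite (bigD1 j)//= [in RHS](bigD1 j)//= ffunE eqxx -addrA (addrC d) addrA.
by congr (_ + _ + _); apply: eq_bigr => i /negbTE ij; rewrite ffunE ij.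
Qed.

Lemma sum_cost_shift_entry (R : realType) (c : 'I_n -> int -> R) M j d :
  \sum_(i < n) c i (shift_entry M j d i) =
  \sum_(i < n) c i (M i) + (c j (M j + d) - c j (M j)).
Proof.
rewrite (bigD1 j)//= [in RHS](bigD1 j)//= ffunE eqxx.
set a := \sum_(_ < _ | _) _; set b := \sum_(_ < _ | _) _.
have -> : a = b by apply: eq_bigr => i /negbTE ij; rewrite ffunE ij.
by ring.
Qed.

End ShiftEntry.

(** * Balanced vectors in separable convex minimization *)

Section Balanced.
Variables (R : realType) (n : nat) (c : 'I_n -> int -> R) (lo hi : int).
Hypothesis c_convex : forall i m, lo <= m - 1 ->
  2 * c i m <= c i (m - 1) + c i (m + 1).
Implicit Types (M W : {ffun 'I_n -> int}) (i j k : 'I_n) (d : int).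

Definition balanced M := forall i j, lo <= M i - 1 -> M j + 1 <= hi ->
  c i (M i) - c i (M i - 1) <= c j (M j + 1) - c j (M j).

(** Marginals are nondecreasing, so a lower bound on the first one holds for all [k] of them, and
    they telescope. *)
Let cost_up i (m : int) (k : nat) (a : R) : lo <= m ->
  a <= c i (m + 1) - c i m -> a * k%:R <= c i (m + k%:Z) - c i m.
Proof.
elim: k m => [|k IHk] m lom am; first by rewrite addr0 mulr0 subrr.
have h : a <= c i (m + 1 + 1) - c i (m + 1).
  have := @c_convex i (m + 1); rewrite addrK => /(_ lom); lra.
have := IHk (m + 1) _ h; rewrite -addrA.
have -> : 1 + k%:Z = k.+1%:Z by lia.
move=> /(_ ltac:(lia)); rewrite -natr1; lra.
Qed.

Let cost_down i (m : int) (k : nat) (a : R) : lo <= m - k%:Z ->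
  (k != 0)%N -> c i m - c i (m - 1) <= a -> c i m - c i (m - k%:Z) <= a * k%:R.
Proof.
elim: k m => [//|k IHk] m lom _ am.
have [k0|k0] := eqVneq k 0%N; first by rewrite k0 mulr1.
have h : c i (m - 1) - c i (m - 1 - 1) <= a.
  have := @c_convex i (m - 1); rewrite subrK => /(_ ltac:(lia)); lra.
have e : m - 1 - k%:Z = m - k.+1%:Z by lia.
have := IHk (m - 1) _ k0 h; rewrite e => /(_ lom); rewrite -natr1; lra.
Qed.

(* A largest left marginal cost [a] separates the marginals of [M], so that
   [a] is a common slope of supporting lines of all the [c i] at [M i]. *)
Lemma balanced_min M W : (forall i, lo <= M i) -> balanced M ->
  (forall i, lo <= W i <= hi) -> \sum_(i < n) W i = \sum_(i < n) M i ->
  \sum_(i < n) c i (M i) <= \sum_(i < n) c i (W i).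
Proof.
move=> loM balM WB sumW.
(* If [W] is nowhere below [M], equal sums force [W = M]. *)
have [i0 Wi0|noW] := pickP (fun i => W i < M i); last first.
  have MW i : M i <= W i by rewrite leNgt noW.
  have WM i : W i = M i.
    apply/eqP; rewrite -subr_eq0; apply/eqP.
    apply: (psumr_eq0P (P := predT) (F := fun i => W i - M i)) => //.
      by move=> k _; rewrite subr_ge0.
    by rewrite sumrB sumW subrr.
  by under [leRHS]eq_bigr do rewrite WM.
(* The maximum runs over the entries that [W] lowers; there [M i - 1 >= W i >= lo], so balance
   applies. *)
case: (@arg_maxP _ _ _ i0 (fun i => W i < M i)
  (fun i => c i (M i) - c i (M i - 1)) Wi0) => k Wk kmax.
set a := c k (M k) - c k (M k - 1) in kmax.
(* Summed over [i], the slope terms cancel because [W] and [M] have the same sum. *)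
suff supp i : a * (W i - M i)%:~R <= c i (W i) - c i (M i).
  rewrite -subr_ge0 -sumrB; apply: le_trans (ler_sum _ (fun i _ => supp i)).
  by rewrite -mulr_sumr -(rmorph_sum (intmul 1)) sumrB sumW subrr mulr0.
have := WB i; have := WB k; have := loM i; have := loM k => Mk Mi Wk' Wi'.
(* Below [M i] the slope [a] is justified by its maximality, above [M i] by balance. *)
have [Wi|MW|->] := ltgtP (W i) (M i); last by rewrite !subrr mulr0.
- pose d := `|M i - W i|%N; have WE : W i = M i - d%:Z by lia.
  have := @cost_down i (M i) d a ltac:(lia) ltac:(lia) (kmax i Wi).
  rewrite -WE; have -> : W i - M i = - d%:Z by lia.
  by rewrite mulrNz mulrN; lra.
- pose d := `|W i - M i|%N; have WE : W i = M i + d%:Z by lia.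
  have := @cost_up i (M i) d a (loM i) (balM k i ltac:(lia) ltac:(lia)).
  by rewrite -WE; have -> : W i - M i = d%:Z by lia.
Qed.

(** Only the marginals at [j] change: the one ahead of the move is controlled by convexity, the one
    behind it by the greedy choice. The bound [hi + 1] ensures that every decrement lands at most at
    [hi]. *)
Lemma balanced_adjust M j d : d = 1 \/ d = -1 ->
  (forall i, lo <= M i <= hi + 1) -> balanced M -> lo <= M j + d <= hi ->
  (forall k, lo <= M k + d <= hi ->
     c j (M j + d) - c j (M j) <= c k (M k + d) - c k (M k)) ->
  balanced (shift_entry M j d).
Proof.
move=> dE MB balM jd jmin i k; rewrite !ffunE.
have /andP[i1 i2] := MB i; have /andP[j1 j2] := MB j; have /andP[k1 k2] := MB k.
case: dE => ?; subst d.
- have [->|ij] := eqVneq i j; have [->|kj] := eqVneq k j.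
  + move=> _ _; have := @c_convex j (M j + 1); rewrite addrK => /(_ ltac:(lia)).
    by lra.
  + by move=> _ kZ; rewrite addrK; apply: jmin; lia.
  + move=> iZ kZ; have := balM i j iZ ltac:(lia).
    have := @c_convex j (M j + 1); rewrite addrK => /(_ ltac:(lia)); lra.
  + exact: balM.
- have [->|ij] := eqVneq i j; have [->|kj] := eqVneq k j.
  + move=> jZ _; have := @c_convex j (M j - 1) jZ; lra.
  + move=> jZ kZ; have := balM j k ltac:(lia) kZ.
    have := @c_convex j (M j - 1) jZ; rewrite subrK; lra.
  + by move=> iZ kZ; have := jmin i ltac:(lia); rewrite subrK; lra.
  + exact: balM.
Qed.

End Balanced.

(** * Invariants, termination and optimality of runs *)

Section Run.
Variables (R : realType) (n : nat) (p : 'I_n -> R) (Z : nat) (g : R -> R).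
Hypotheses (p_prob : prob_vector p) (p_gt0 : forall i, 0 < p i).
Hypotheses (Z_gt0 : (0 < Z)%N).
Hypothesis g_convex : convex_function (E := R^o) `]0, +oo[ g.
Implicit Types (M W : {ffun 'I_n -> int}) (i j : 'I_n) (s : state n).

Let c : 'I_n -> int -> R := cost p Z g.
Let lo : int := min_count g.
(** The upper bound exceeds [Z] by 1 because rounding up may give [Z + 1] when [p i = 1]. *)
Let box M := forall i, lo <= M i <= Z%:Z + 1.

Let lo_ge0 : 0 <= lo := @min_count_ge0 R g.
Let lo_le1 : lo <= 1 := @min_count_le1 R g.

Let c_convex i (m : int) : lo <= m - 1 -> 2 * c i m <= c i (m - 1) + c i (m + 1).
Proof. exact: cost_convex. Qed.

Let box_epsE M i (d : int) : box M -> eps p Z g M i d =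
  if lo <= M i + d <= Z%:Z then (c i (M i + d) - c i (M i))%:E else +oo%E.
Proof. by move=> MB; apply: epsE => //; have /andP[] := MB i. Qed.

Let in_box M (j : 'I_n) (d : int) : box M -> lo <= M j + d <= Z%:Z ->
  box (shift_entry M j d).
Proof.
move=> MB jd i; rewrite ffunE; case: eqP => [->|_]; last exact: MB.
by lia.
Qed.

Lemma init_vector_box i : lo <= init_vector p Z g i <= Z%:Z + 1.
Proof.
rewrite ffunE /=; set m := Num.floor (Z%:R * p i).
have p_le1 : p i <= 1.
  rewrite -p_prob.2 (bigD1 i)//= lerDl.
  by apply: sumr_ge0 => j _; exact: p_prob.1.
have m_ge0 : 0 <= m by rewrite floor_ge0 mulr_ge0// ltW.
have m_leZ : m <= Z%:Z.
  rewrite -(ler_int R); apply: le_trans (floor_le_tmp _) _.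
  by rewrite -[leRHS]mulr1 ler_wpM2l.
case: ifPn => [gm|_]; last by move: lo_le1; lia.
have [//|m_lo] := leP lo m; first by lia.
have m1 : lo <= m + 1 by move: lo_le1; lia.
(* Rounding down to a count of infinite cost would require infinite cost at [m + 1] too. *)
move: gm; rewrite gext_count_pinfty// leye_eq => /eqP gm.
by have := gext_count_fin p_gt0 Z_gt0 g_convex i m1; rewrite gm.
Qed.

Lemma exchange_box M M' : box M -> exchange p Z g M M' ->
  [/\ box M', \sum_(i < n) M' i = \sum_(i < n) M i
    & \sum_(i < n) c i (M' i) < \sum_(i < n) c i (M i)].
Proof.
move=> MB [j [j' [[jj' _] + ->]]]; rewrite /eps2 !box_epsE//.
(* A negative total excludes [+oo], so both moves stay in range. *)
case: ifPn => j1; case: ifPn => j'1 //; rewrite -EFinD lte_fin => lt0.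
have MB' : box (shift_entry M j 1) by exact: in_box.
have Mj' : shift_entry M j 1 j' = M j' by rewrite ffunE eq_sym (negbTE jj').
split.
- by apply: in_box => //; rewrite Mj'.
- by rewrite !sum_shift_entry addrK.
- by rewrite !sum_cost_shift_entry Mj'; lra.
Qed.

(** Two distinct indices violating balance give a negative exchange, so the best pair is negative as
    well and can be exchanged. Equal indices are settled by convexity. *)
Lemma no_exchange_balanced M : box M -> (forall M', ~ exchange p Z g M M') ->
  balanced c lo Z M.
Proof.
move=> MB noM i j iM jM; have [ij|ij] := eqVneq i j.
  by move: iM; rewrite ij => /(c_convex j); lra.
rewrite leNgt; apply/negP => lt.
pose P (k : 'I_n * 'I_n) := k.1 != k.2.
have Pji : P (j, i) by rewrite /P eq_sym.
case: (@arg_minP _ _ _ _ P (fun k => eps2 p Z g M k.1 k.2) Pji) => -[k k'] kk' kmin.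
apply: (noM (shift_entry (shift_entry M k 1) k' (-1))); exists k, k'; split => //.
  by split => // l l' ll'; exact: (kmin (l, l')).
apply: le_lt_trans (kmin (j, i) Pji) _ => /=.
have /andP[i1 i2] := MB i; have /andP[j1 j2] := MB j.
rewrite /eps2 !box_epsE// !ifT; [|lia|lia].
by rewrite -EFinD lte_fin; lra.
Qed.

(* When [lo *+ n > Z], every count vector has infinite divergence, so that
   balance need not be maintained (and is indeed lost). *)
Let invariant s : Prop :=
  match s with
  | Exchanging M => box M
  | Adjusting k d M =>
      [/\ d = 1 \/ d = -1, forall i, 0 <= M i <= Z%:Z + 1,
          \sum_(i < n) M i + d * k%:Z = Z%:Z
        & lo *+ n <= Z%:Z -> box M /\ balanced c lo Z M]
  | Returned M =>
      [/\ forall i, 0 <= M i, \sum_(i < n) M i = Z%:Z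
        & lo *+ n <= Z%:Z -> box M /\ balanced c lo Z M]
  end.

Let sum_lo M : (forall i, M i <= lo) -> \sum_(i < n) M i <= lo *+ n.
Proof.
move=> Mlo; rewrite -[X in _ *+ X](card_ord n) -sumr_const.
exact: ler_sum.
Qed.

(** An increment cannot fall below [lo]. For a decrement the sum exceeds [Z >= lo *+ n], so some
    entry exceeds [lo] and offers a finite cost, which the minimizer cannot exceed. *)
Let finite_move M (d : int) (k : nat) : d = 1 \/ d = -1 -> box M ->
  \sum_(i < n) M i + d * k.+1%:Z = Z%:Z -> lo *+ n <= Z%:Z ->
  forall j, in_range Z M j d -> (forall i, (eps p Z g M j d <= eps p Z g M i d)%E) ->
  lo <= M j + d <= Z%:Z.
Proof.
move=> dE MB sumM loZ j jd jmin; have /andP[j1 j2] := MB j.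
move: jd => /andP[jd1 jd2].
case: dE => ?; subst d; first by lia.
have [i iM|noM] := pickP (fun i => lo < M i); last first.
  have Mlo i : M i <= lo by rewrite leNgt noM.
  by have := sum_lo Mlo; lia.
have /andP[i1 i2] := MB i.
have := jmin i; rewrite !box_epsE// [X in (_ <= X)%E -> _]ifT; last by lia.
by case: ifP.
Qed.

Let invariant_step s s' : step p Z g s s' -> invariant s -> invariant s'.
Proof.
case=> /=.
- by move=> M M' /exchange_box MM' /MM'[].
- move=> M noM sM MB; split.
  + by move=> i; have /andP[] := MB i; lia.
  + by apply/eqP; rewrite -subr_eq0; exact/eqP.
  + by move=> _; split => //; exact: no_exchange_balanced.
- move=> M noM sM MB; split.
  + by rewrite /adjust_sign; case: ifP; [left|right].
  + by move=> i; have /andP[] := MB i; lia.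
  + have sE : \sum_(i < n) M i = surplus Z M + Z%:Z by rewrite subrK.
    by rewrite sE /adjust_sign; case: ifP; lia.
  + by move=> _; split => //; exact: no_exchange_balanced.
- move=> k d M M' [j [jd jmin ->]] [dE M0 sumM HM]; split => //.
  + move=> i; rewrite ffunE; case: eqP => [->|//].
    by move: jd => /andP[]; lia.
  + by rewrite sum_shift_entry -sumM intS; ring.
  + move=> loZ; have [MB balM] := HM loZ.
    have jr := finite_move dE MB sumM loZ jd jmin.
    split; first exact: in_box.
    apply: (balanced_adjust c_convex) => // i ir.
    by have := jmin i; rewrite !box_epsE// jr ir lee_fin.
- move=> d M [_ M0 sumM HM]; split => //; last by lia.
  by move=> i; have /andP[] := M0 i.
Qed.

Let reachable_invariant s : reachable p Z g s -> invariant s.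
Proof.
have inv0 : invariant (initial_state p Z g) by exact: init_vector_box.
suff H : forall s1 s2, clos_refl_trans _ (step p Z g) s1 s2 ->
    invariant s1 -> invariant s2 by move=> /H; apply.
move=> s1 s2; elim => [s3 s4|//|s3 s4 s5 _ H1 _ H2 /H1//].
exact: invariant_step.
Qed.

Let progress s : invariant s ->
  (exists M, s = Returned M) \/ (exists s', step p Z g s s').
Proof.
case: s => [M|[|k] d M|M] /=; last by left; exists M.
- move=> MB; right.
  have [[M' MM']|noM] := pselect (exists M', exchange p Z g M M').
    by exists (Exchanging M'); exact: StepExchange.
  have {}noM M' : ~ exchange p Z g M M' by move=> MM'; apply: noM; exists M'.
  have [s0|s0] := eqVneq (surplus Z M) 0.
    by exists (Returned M); exact: StepStop0.
  by eexists; exact: StepStop.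
- by move=> _; right; exists (Returned M); exact: StepReturn.
- move=> [dE M0 sumM _]; right.
  (* A minimizer over the in-range entries is a minimizer over all, since the others cost [+oo]. *)
  suff [j0 j0d] : exists j, in_range Z M j d.
    case: (@arg_minP _ _ _ _ (fun j => in_range Z M j d) (fun j => eps p Z g M j d) j0d).
    move=> j jd jmin; exists (Adjusting k d (shift_entry M j d)).
    apply: StepAdjust; exists j; split => // i.
    have [id|id] := boolP (in_range Z M i d); first exact: jmin.
    by rewrite {2}/eps (negbTE id) leey.
  case: dE => ?; subst d.
  (* The sum is below [Z], so the nonnegative entries cannot all reach [Z]; an index exists because
     [p] sums to 1. *)
  + have [j jZ|noM] := pickP (fun j => M j < Z%:Z).
      by exists j; rewrite /in_range; have := M0 j; lia.
    have [i _|no] := pickP (fun i : 'I_n => true); last first.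
      by have := p_prob.2; rewrite big_pred0// => /eqP; rewrite eq_sym oner_eq0.
    have : M i <= \sum_(j < n) M j.
      rewrite [leRHS](bigD1 i)//= lerDl; apply: sumr_ge0 => j _.
      by have /andP[] := M0 j.
    have := noM i; have key (S : int) : S + 1 * k.+1%:Z = Z%:Z -> S < Z%:Z by lia.
    by move=> /negbT; rewrite -leNgt => ZM /(le_trans ZM); rewrite leNgt key.
  + have [j jZ|noM] := pickP (fun j => 0 < M j).
      by exists j; rewrite /in_range; have := M0 j; lia.
    have : \sum_(i < n) M i <= 0 by apply: sumr_le0 => i _; rewrite leNgt noM.
    have key (S : int) : S + -1 * k.+1%:Z = Z%:Z -> 0 < S by lia.
    by rewrite leNgt key.
Qed.

(** [Adjusting] counts down and [Returned] has no successor, so an infinite run would stay in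
    [Exchanging]. Its strictly decreasing costs make the vectors distinct, against the pigeonhole
    principle. *)
Let no_infinite_run (s : nat -> state n) : s 0%N = initial_state p Z g ->
  ~ forall k, step p Z g (s k) (s k.+1).
Proof.
move=> s0 st.
have inv k : invariant (s k).
  elim: k => [|k]; first by rewrite s0; exact: init_vector_box.
  exact: invariant_step (st k).
have not_returned k M : s k <> Returned M.
  by move=> sk; have := st k; rewrite sk => H; inversion H.
have not_adjusting m : forall k d M, s k <> Adjusting m d M.
  elim: m => [|m IHm] k d M sk; have := st k; rewrite sk => H; inversion H.
    exact: (not_returned k.+1 M).
  exact: (IHm k.+1 d M').
have /boolp.choice[M sM] : forall k, exists M, s k = Exchanging M.
  move=> k; case sk: (s k) => [M|m d M|M]; first by exists M.
    by have := not_adjusting m k d M sk.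
  by have := not_returned k M sk.
have MB k : box (M k) by have := inv k; rewrite sM.
pose cM k := \sum_(i < n) c i (M k i).
have cM_decr : {homo cM : k l / (k < l)%N >-> l < k}.
  apply: homo_ltn => [x y z xy yz|k]; first exact: lt_trans yz xy.
  have := st k; rewrite !sM => H; inversion H.
  by have [] := @exchange_box (M k) (M k.+1) (MB k) ltac:(assumption).
(* The box leaves [Z + 2] values [0, ..., Z + 1] for each entry. *)
pose T := {ffun 'I_n -> 'I_Z.+2}.
pose enc (k : 'I_#|T|.+1) : T := [ffun i => inord `|M k i|%N].
suff /leq_card : injective enc by rewrite card_ord ltnn.
move=> k l /ffunP kl.
have kl' : M k = M l.
  apply/ffunP => i; have := kl i; rewrite !ffunE => /(congr1 val) /=.
  have := MB k i; have := MB l i; have := lo_ge0 => lo0 Bl Bk.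
  by rewrite !inordK; lia.
apply: ord_inj; case: (ltngtP k l) => // kl_lt.
  by have := cM_decr _ _ kl_lt; rewrite /cM kl' ltxx.
by have := cM_decr _ _ kl_lt; rewrite /cM kl' ltxx.
Qed.

Lemma run_terminates : terminates p Z g.
Proof.
split; first by move=> [s [s0 st]]; exact: (no_infinite_run s0 st).
by move=> s /reachable_invariant/progress.
Qed.

Lemma run_returns M : returns p Z g M ->
  [/\ forall i, 0 <= M i, \sum_(i < n) M i = Z%:Z
    & lo *+ n <= Z%:Z -> (forall i, lo <= M i) /\ balanced c lo Z M].
Proof.
move=> /reachable_invariant[M0 sumM HM]; split => // /HM[MB ?]; split => // i.
by have /andP[] := MB i.
Qed.

(** A competitor with an entry below [lo] has infinite divergence. Any other one has sum at least
    [lo *+ n], so [lo *+ n <= Z] and the returned vector is balanced. *)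
Lemma run_optimal M W : returns p Z g M -> count_vectors Z W ->
  (fdiv_count g p Z M <= fdiv_count g p Z W)%E.
Proof.
move=> /run_returns[M0 sumM HM] [W0 sumW].
have [i Wi|noW] := pickP (fun i => W i < lo).
  by rewrite (fdiv_count_pinfty p_gt0 Z_gt0 g_convex W0 Wi) leey.
have loW i : lo <= W i by rewrite leNgt noW.
have loZ : lo *+ n <= Z%:Z.
  rewrite -sumW -[X in _ *+ X](card_ord n) -sumr_const; exact: ler_sum.
have [loM balM] := HM loZ.
rewrite !fdiv_count_fin// lee_fin.
apply: (balanced_min c_convex) balM _ _ => //; last by rewrite sumM.
move=> i; rewrite loW/= -sumW (bigD1 i)//= lerDl.
by apply: sumr_ge0 => j _; exact: W0.
Qed.

End Run.

(** * Count vectors as [Z]-type distributions, and the conclusion *)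

Lemma count_vectors_Ztype (R : realType) (n Z : nat) (M : {ffun 'I_n -> int}) :
  (0 < Z)%N -> count_vectors Z M -> Ztype Z (empirical R Z M).
Proof.
move=> Z_gt0 [M0 sumM].
have Z0 : Z%:R != 0 :> R by rewrite pnatr_eq0 -lt0n.
split; first split.
- by move=> i; rewrite /empirical divr_ge0 ?ler0z.
- by rewrite /empirical -mulr_suml -(rmorph_sum (intmul 1)) sumM divff.
- move=> i; exists `|M i|%N; split.
    have : M i <= Z%:Z.
      rewrite -sumM (bigD1 i)//= lerDl; apply: sumr_ge0 => j _; exact: M0.
    by have := M0 i; lia.
  by rewrite /empirical natr_absz ger0_norm.
Qed.

Lemma Ztype_empirical (R : realType) (n Z : nat) (q : 'I_n -> R) :
  (0 < Z)%N -> Ztype Z q ->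
  exists2 M : {ffun 'I_n -> int}, count_vectors Z M & q = empirical R Z M.
Proof.
move=> Z_gt0 [[q0 sumq] /boolp.choice[k kq]].
have Z0 : Z%:R != 0 :> R by rewrite pnatr_eq0 -lt0n.
have qE : q = empirical R Z [ffun i => (k i)%:Z].
  by apply/funext => i; rewrite /empirical ffunE (kq i).2.
exists [ffun i => (k i)%:Z] => //; split; first by move=> i; rewrite ffunE.
(* The integer identity is checked in [R] after division by [Z], where it reads [\sum q i = 1]. *)
apply: (@intr_inj R); rewrite rmorph_sum/=.
apply: (mulIf (invr_neq0 Z0)); rewrite mulr_suml divff// -[RHS]sumq qE.
by apply: eq_bigr.
Qed.

Lemma fdiv_empirical (R : realType) (n Z : nat) (g : R -> R) (p : 'I_n -> R)
    (M : {ffun 'I_n -> int}) :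
  fdiv g p (empirical R Z M) = fdiv_count g p Z M.
Proof. by apply: eq_bigr => i _; rewrite /empirical -mulrA -invfM. Qed.

Theorem theorem4p7 (R : realType) (n : nat) (p : 'I_n -> R) (Z : nat)
    (g : R -> R)
    (p_prob : prob_vector p) (p_gt0 : forall i, 0 < p i) (Z_gt0 : (0 < Z)%N)
    (g_convex : convex_function (E := R^o) `]0, +oo[ g) (g1 : g 1 = 0) :
  terminates p Z g /\
  forall M : {ffun 'I_n -> int}, returns p Z g M ->
    [/\ count_vectors Z M,
        forall W : {ffun 'I_n -> int}, count_vectors Z W ->
          (fdiv_count g p Z M <= fdiv_count g p Z W)%E,
        Ztype Z (empirical R Z M)
      & forall q : 'I_n -> R, Ztype Z q ->
          (fdiv g p (empirical R Z M) <= fdiv g p q)%E].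
Proof.
split; first exact: run_terminates.
move=> M retM.
have countM : count_vectors Z M.
  by have [M0 sumM _] := run_returns p_prob p_gt0 Z_gt0 g_convex retM.
have optM W : count_vectors Z W ->
    (fdiv_count g p Z M <= fdiv_count g p Z W)%E by exact: run_optimal.
split => //; first exact: count_vectors_Ztype.
move=> q /(Ztype_empirical Z_gt0)[W countW ->].
by rewrite !fdiv_empirical; exact: optM.
Qed.
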